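(* Let $\mathcal{X}$ and $\mathcal{Y}$ be complex Banach spaces, and suppose that $A\in L(\mathcal{X})$ and $B\in L(\mathcal{Y})$ each admit a generalized Kato decomposition. If there exists some $C\in L(\mathcal{Y},\mathcal{X})$ such that $M_C=\begin{pmatrix} A & C\\ 0 & B\end{pmatrix}\in L(\mathcal{X}\oplus\mathcal{Y})$ is generalized Drazin invertible, then the following hold: (i) there are closed $A$-invariant subspaces $\mathcal{X}_1,\mathcal{X}_2$ of $\mathcal{X}$ with $\mathcal{X}=\mathcal{X}_1\oplus\mathcal{X}_2$ such that $A|_{\mathcal{X}_1}\in L(\mathcal{X}_1)$ is bounded below and $A|_{\mathcal{X}_2}\in L(\mathcal{X}_2)$ is quasinilpotent; (ii) there are closed $B$-invariant subspaces $\mathcal{Y}_1,\mathcal{Y}_2$ of $\mathcal{Y}$ with $\mathcal{Y}=\mathcal{Y}_1\oplus\mathcal{Y}_2$ such that $B|_{\mathcal{Y}_1}\in L(\mathcal{Y}_1)$ is surjective and $B|_{\mathcal{Y}_2}\in L(\mathcal{Y}_2)$ is quasinilpotent; (iii) there exists a constant $\delta>0$ such that $\beta(A-\lambda)=\alpha(B-\lambda)$ for every $\lambda\in\mathbb{C}$ with $0<|\lambda|<\delta$.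
   Context: $L(\mathcal{X},\mathcal{Y})$ is the set of bounded linear operators from $\mathcal{X}$ to $\mathcal{Y}$, and $L(\mathcal{X})=L(\mathcal{X},\mathcal{X})$. $T-\lambda$ means $T-\lambda I$. The space $\mathcal{X}\oplus\mathcal{Y}$ of pairs carries the norm $\|(x,y)\|=(\|x\|^2+\|y\|^2)^{1/2}$, and $M_C(x,y)=(Ax+Cy,By)$. For $T\in L(\mathcal{X})$, $N(T)$ and $R(T)$ are the kernel and range, $\alpha(T)=\dim N(T)$, $\beta(T)=\operatorname{codim} R(T)$, with values in $\{0,1,2,\dots\}\cup\{\infty\}$. $T\in L(\mathcal{X})$ is bounded below if there is $c>0$ with $c\|x\|\le\|Tx\|$ for all $x\in\mathcal{X}$. $T$ is quasinilpotent if $T-\lambda$ is invertible for all complex $\lambda\neq0$. $T$ is generalized Drazin invertible if there exists $S\in L(\mathcal{X})$ with $TS=ST$, $STS=S$ and $TST-T$ quasinilpotent. $T\in L(\mathcal{X})$ is semi-regular if $R(T)$ is closed and $N(T)\subset R(T^m)$ for every $m\in\mathbb{N}$. $T$ admits a generalized Kato decomposition if there are closed $T$-invariant subspaces $M,N$ of $\mathcal{X}$ with $\mathcal{X}=M\oplus N$ such that $T|_M\in L(M)$ is semi-regular and $T|_N\in L(N)$ is quasinilpotent. *)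

(* Defs.v *)
From HB Require Import structures.
From mathcomp Require Import all_boot all_order all_algebra.
From mathcomp Require Import all_classical all_reals all_analysis.
From mathcomp Require Import complex ring.

Set Implicit Arguments.
Unset Strict Implicit.
Unset Printing Implicit Defensive.

Import Order.TTheory GRing.Theory Num.Theory.
Import numFieldNormedType.Exports.

Local Open Scope classical_set_scope.
Local Open Scope ring_scope.

(* Norms take values in the scalar field K. For K = R[i] the order is partial:
   0 <= c and 0 < c entail that c is real, so the constants below are real. *)
HB.mixin Record isBoundedOperator (K : numFieldType) (X Y : normedModType K)
    (T : X -> Y) := {
  bounded_operator_subproof : exists c : K, forall x, `|T x| <= c * `|x|
}.

#[short(type="boundedOperator")]
HB.structure Definition BoundedOperator (K : numFieldType)
    (X Y : normedModType K) :=
  {T of @GRing.Linear K X Y *:%R T & isBoundedOperator K X Y T}.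

Notation "''L' ( X , Y )" := (boundedOperator X Y)
  (at level 8, format "''L' ( X ,  Y )") : type_scope.
Notation "''L' ( X )" := (boundedOperator X X)
  (at level 8, format "''L' ( X )") : type_scope.

Section OperatorAlgebra.
Context (K : numFieldType).

Lemma bounded_operatorP (X Y : normedModType K) (T : 'L(X, Y)) :
  exists2 c : K, 0 <= c & forall x, `|T x| <= c * `|x|.
Proof.
have [c cT] := @bounded_operator_subproof _ _ _ T.
have [x0|x0] := pselect (forall x : X, `|x| = 0).
  by exists 0 => // x; have := cT x; rewrite x0 !mulr0.
have [x xN0] : exists x : X, `|x| != 0.
  by apply: contra_notP x0 => /forallNP h x; apply/eqP/negPn/negP/h.
exists c => //; have x_gt0 : 0 < `|x| by rewrite lt_neqAle eq_sym xN0 normr_ge0.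
by rewrite -(pmulr_lge0 _ x_gt0) (le_trans _ (cT x)).
Qed.

Context (X Y Z : normedModType K).

Fact idfun_bounded : exists c : K, forall x : X, `|idfun x| <= c * `|x|.
Proof. by exists 1 => x; rewrite mul1r. Qed.
HB.instance Definition _ := isBoundedOperator.Build K X X idfun idfun_bounded.

Fact comp_bounded (S : 'L(Y, Z)) (T : 'L(X, Y)) :
  exists c : K, forall x, `|(S \o T) x| <= c * `|x|.
Proof.
have [c c0 cS] := bounded_operatorP S; have [d d0 dT] := bounded_operatorP T.
exists (c * d) => x; rewrite (le_trans (cS _))// -mulrA.
by rewrite ler_wpM2l.
Qed.
HB.instance Definition _ (S : 'L(Y, Z)) (T : 'L(X, Y)) :=
  isBoundedOperator.Build K X Z (S \o T) (comp_bounded S T).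

Fact sub_bounded (S T : 'L(X, Y)) :
  exists c : K, forall x, `|(S \- T) x| <= c * `|x|.
Proof.
have [c c0 cS] := bounded_operatorP S; have [d d0 dT] := bounded_operatorP T.
exists (c + d) => x; rewrite (le_trans (ler_normB _ _))// mulrDl.
by rewrite lerD.
Qed.
HB.instance Definition _ (S T : 'L(X, Y)) :=
  isBoundedOperator.Build K X Y (S \- T) (sub_bounded S T).

Fact scale_bounded (a : K) (T : 'L(X, Y)) :
  exists c : K, forall x, `|(a \*: T) x| <= c * `|x|.
Proof.
have [c c0 cT] := bounded_operatorP T.
by exists (`|a| * c) => x; rewrite normrZ -mulrA ler_wpM2l.
Qed.
HB.instance Definition _ (a : K) (T : 'L(X, Y)) :=
  isBoundedOperator.Build K X Y (a \*: T) (scale_bounded a T).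

End OperatorAlgebra.


Record closedSubspace (K : numFieldType) (X : normedModType K) :=
  ClosedSubspace {
    subspace_set :> set X ;
    subspace_submod_closed : submod_closed (mem subspace_set) ;
    subspace_closed : closed subspace_set }.

(* The elements of M form a normed space [subspace_type M] of their own, with
   the norm of X (complete if X is), so that T|_M is a genuine element of L(M).
   The carrier is a dedicated record because the library's subtype of a set
   already has a topology, not known to be given by a norm. *)
Section SubspaceAsSpace.
Context (K : numFieldType) (X : normedModType K) (M : closedSubspace X).

Definition subspace_pred : {pred X} := mem (subspace_set M).

HB.instance Definition _ :=
  GRing.isSubmodClosed.Build K X subspace_pred (subspace_submod_closed M).

Record subspace_type := SubspaceType {
  subspace_val : X ;
  subspace_valP : subspace_val \in subspace_pred }.

HB.instance Definition _ := [isSub of subspace_type for subspace_val].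
HB.instance Definition _ := [Choice of subspace_type by <:].
HB.instance Definition _ := [SubChoice_isSubLmodule of subspace_type by <:].

Let nrm (u : subspace_type) : K := `|val u|.

Fact subspace_normD u v : nrm (u + v) <= nrm u + nrm v.
Proof. by rewrite /nrm raddfD ler_normD. Qed.

Fact subspace_normZ (a : K) u : nrm (a *: u) = `|a| * nrm u.
Proof. by rewrite /nrm linearZ normrZ. Qed.

Fact subspace_norm0_eq0 u : nrm u = 0 -> u = 0.
Proof. by move/normr0_eq0 => u0; apply: val_inj; rewrite raddf0. Qed.

HB.instance Definition _ := Lmodule_isNormed.Build K subspace_type
  subspace_normD subspace_normZ subspace_norm0_eq0.

Lemma subspace_normE (u : subspace_type) : `|u| = `|val u|.
Proof. by []. Qed.

End SubspaceAsSpace.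

Section SubspaceComplete.
Context (K : numFieldType) (X : completeNormedModType K)
  (M : closedSubspace X).

Fact subspace_complete (F : set_system (subspace_type M)) :
  ProperFilter F -> cauchy F -> cvg F.
Proof.
move=> FF /cauchy_ballP Fc.
pose G : set_system X := (val : subspace_type M -> X) @ F.
have Gc : cauchy G.
  apply/cauchy_ballP => e e0; have [[A B] /= [FA FB] AB] := Fc _ e0.
  exists (val @` A, val @` B) => /=.
    by split; [apply: filterS FA|apply: filterS FB] => u ?; exists u.
  move=> [_ _] [/= [a Aa <-] [b Bb <-]].
  have := AB (a, b) (conj Aa Bb).
  by rewrite /= -!ball_normE /= subspace_normE raddfB.
have GF : ProperFilter G by exact: fmap_proper_filter.
have /cvg_ex[x /= Gx] : cvg G by exact: cauchy_cvg.
have Mx : x \in subspace_pred M.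
  apply/mem_set; apply: (subspace_closed (c := M)).
  move=> B /Gx; rewrite /G /= => FB.
  have [u Bu] := @filter_ex _ F _ _ FB.
  by exists (val u); split => //; apply: set_mem; exact: valP u.
apply/cvg_ex; exists (SubspaceType Mx).
apply/cvgrPdist_lt => e e0.
move/cvgrPdist_lt : Gx => /(_ e e0).
by rewrite /G; apply: filterS => u; rewrite /= subspace_normE raddfB.
Qed.

HB.instance Definition _ := Uniform_isComplete.Build (subspace_type M) subspace_complete.

End SubspaceComplete.

Definition invariant_subspace (K : numFieldType) (X : normedModType K) (T : 'L(X))
    (M : closedSubspace X) : Prop :=
  T @` M `<=` M.

Definition is_direct_sum (K : numFieldType) (X : normedModType K)
    (M N : closedSubspace X) : Prop :=
  M `&` N = [set 0] /\ [set m + n | m in M & n in N] = [set: X].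

Section Restriction.
Context (K : numFieldType) (X : normedModType K) (T : 'L(X))
  (M : closedSubspace X) (TM : invariant_subspace T M).

Fact restriction_subproof (u : subspace_type M) : T (val u) \in subspace_pred M.
Proof. by apply/mem_set/TM; exists (val u) => //; apply/set_mem/(valP u). Qed.

Definition restriction (u : subspace_type M) : subspace_type M :=
  SubspaceType (restriction_subproof u).

Fact restriction_linear : linear restriction.
Proof. by move=> a u v; apply: val_inj; rewrite /= !linearP. Qed.
HB.instance Definition _ := GRing.isLinear.Build K (subspace_type M)
  (subspace_type M) *:%R restriction restriction_linear.

Fact restriction_bounded : exists c : K, forall u, `|restriction u| <= c * `|u|.
Proof. by have [c _ cT] := bounded_operatorP T; exists c => u; apply: cT. Qed.
HB.instance Definition _ := isBoundedOperator.Build K (subspace_type M)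
  (subspace_type M) restriction restriction_bounded.

End Restriction.

(* The library norm on X * Y is the maximum of the two norms; [hsum X Y] is an
   alias of X * Y carrying the Euclidean combination of the norms instead. *)
Definition hsum (K : numClosedFieldType) (X Y : normedModType K) : Type :=
  (X * Y)%type.

Section HilbertSum.
Context (K : numClosedFieldType) (X Y : normedModType K).

HB.instance Definition _ := GRing.Lmodule.copy (hsum X Y) (X * Y)%type.

Definition hsum_norm (z : hsum X Y) : K :=
  sqrtC (`|z.1| ^+ 2 + `|z.2| ^+ 2).

Let sq_ge0 (z : hsum X Y) : 0 <= `|z.1| ^+ 2 + `|z.2| ^+ 2.
Proof. by rewrite addr_ge0 ?exprn_ge0. Qed.

Fact hsum_normD (z w : hsum X Y) :
  hsum_norm (z + w) <= hsum_norm z + hsum_norm w.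
Proof.
have sqr_le (x y : K) : 0 <= x -> 0 <= y -> x ^+ 2 <= y ^+ 2 -> x <= y.
  by move=> x0 y0; rewrite ler_sqr ?nnegrE.
apply: (sqr_le _ _); rewrite ?addr_ge0 ?sqrtC_ge0//.
rewrite sqrrD !sqrtCK.
set a := `|z.1|; set b := `|z.2|; set c := `|w.1|; set d := `|w.2|.
have [a0 b0] : 0 <= a /\ 0 <= b by split; exact: normr_ge0.
have [c0 d0] : 0 <= c /\ 0 <= d by split; exact: normr_ge0.
have CS : a * c + b * d <= hsum_norm z * hsum_norm w.
  apply: (sqr_le _ _); rewrite ?addr_ge0 ?mulr_ge0 ?sqrtC_ge0//.
  rewrite exprMn !sqrtCK -/a -/b -/c -/d -subr_ge0.
  have -> : (a ^+ 2 + b ^+ 2) * (c ^+ 2 + d ^+ 2) - (a * c + b * d) ^+ 2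
    = (a * d - b * c) ^+ 2 by ring.
  by rewrite real_exprn_even_ge0// rpredB// ger0_real// mulr_ge0.
apply: (@le_trans _ _ ((a + c) ^+ 2 + (b + d) ^+ 2)).
  by rewrite lerD// ler_sqr ?nnegrE ?addr_ge0 ?ler_normD.
have -> : (a + c) ^+ 2 + (b + d) ^+ 2
  = a ^+ 2 + b ^+ 2 + (a * c + b * d) *+ 2 + (c ^+ 2 + d ^+ 2) by ring.
by rewrite lerD2r lerD2l lerMn2r.
Qed.

Fact hsum_normZ (a : K) (z : hsum X Y) : hsum_norm (a *: z) = `|a| * hsum_norm z.
Proof.
rewrite /hsum_norm /= !normrZ !exprMn -mulrDr rootCMl ?exprn_ge0//.
by rewrite sqrCK.
Qed.

Fact hsum_norm0_eq0 (z : hsum X Y) : hsum_norm z = 0 -> z = 0.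
Proof.
move/eqP; rewrite sqrtC_eq0 paddr_eq0 ?exprn_ge0// !sqrf_eq0 !normr_eq0.
by case: z => x y /= /andP[/eqP -> /eqP ->].
Qed.

HB.instance Definition _ := Lmodule_isNormed.Build K (hsum X Y)
  hsum_normD hsum_normZ hsum_norm0_eq0.

Lemma hsum_normE (z : hsum X Y) :
  `|z| = sqrtC (`|z.1| ^+ 2 + `|z.2| ^+ 2).
Proof. by []. Qed.

Lemma hsum_norm_fst (z : hsum X Y) : `|z.1| <= `|z|.
Proof.
rewrite hsum_normE -[leLHS]sqrCK// ler_sqrtC ?qualifE//= ?exprn_ge0//.
by rewrite lerDl exprn_ge0.
Qed.

Lemma hsum_norm_snd (z : hsum X Y) : `|z.2| <= `|z|.
Proof.
rewrite hsum_normE -[leLHS]sqrCK// ler_sqrtC ?qualifE//= ?exprn_ge0//.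
by rewrite lerDr exprn_ge0.
Qed.

Lemma hsum_norm_le (z : hsum X Y) : `|z| <= `|z.1| + `|z.2|.
Proof.
have s0 : 0 <= `|z.1| + `|z.2| by rewrite addr_ge0.
rewrite hsum_normE -[leRHS]sqrCK// ler_sqrtC ?qualifE//= ?exprn_ge0//.
by rewrite sqrrD lerD2r lerDl mulrn_wge0// mulr_ge0.
Qed.

End HilbertSum.

Section HilbertSumComplete.
Context (K : numClosedFieldType) (X Y : completeNormedModType K).

Fact hsum_complete (F : set_system (hsum X Y)) :
  ProperFilter F -> cauchy F -> cvg F.
Proof.
move=> FF /cauchy_ballP Fc.
have lip (Z : completeNormedModType K) (f : {linear hsum X Y -> Z}) :
    (forall z, `|f z| <= `|z|) -> exists l : Z, f @ F --> l.
  move=> f1; have fFF : ProperFilter (f @ F) by exact: fmap_proper_filter.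
  suff /cauchy_cvg /cvg_ex[l fFl] : cauchy (f @ F) by exists l.
  apply/cauchy_ballP => e e0.
  have [[A B] /= [FA FB] AB] := Fc _ e0.
  exists (f @` A, f @` B) => /=.
    by split; [apply: filterS FA|apply: filterS FB] => u ?; exists u.
  move=> [_ _] [/= [a Aa <-] [b Bb <-]].
  have := AB (a, b) (conj Aa Bb).
  by rewrite -!ball_normE /= -raddfB => /(le_lt_trans (f1 _)).
have [x /cvgrPdist_lt Fx] := lip X fst (@hsum_norm_fst _ X Y).
have [y /cvgrPdist_lt Fy] := lip Y snd (@hsum_norm_snd _ X Y).
apply/cvg_ex; exists ((x, y) : hsum X Y); apply/cvgrPdist_lt => e e0.
have e20 : 0 < e / 2 by rewrite divr_gt0.
near=> z; rewrite (le_lt_trans (hsum_norm_le _))// [e]splitr ltrD//=.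
  by near: z; exact: Fx.
by near: z; exact: Fy.
Unshelve. all: by end_near. Qed.

HB.instance Definition _ := Uniform_isComplete.Build (hsum X Y) hsum_complete.

End HilbertSumComplete.

Section UpperTriangular.
Context (K : numClosedFieldType) (X Y : normedModType K).
Context (A : 'L(X)) (B : 'L(Y)) (C : 'L(Y, X)).

Definition upper_triangular (z : hsum X Y) : hsum X Y :=
  (A z.1 + C z.2, B z.2).

Fact upper_triangular_linear : linear upper_triangular.
Proof.
move=> a z w; rewrite /upper_triangular /= !linearP.
by congr pair; rewrite /= scalerDr addrACA.
Qed.
HB.instance Definition _ := GRing.isLinear.Build K (hsum X Y) (hsum X Y) *:%R
  upper_triangular upper_triangular_linear.

Fact upper_triangular_bounded :
  exists c : K, forall z, `|upper_triangular z| <= c * `|z|.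
Proof.
have [a a0 aA] := bounded_operatorP A; have [b b0 bB] := bounded_operatorP B.
have [c c0 cC] := bounded_operatorP C.
exists (a + c + b) => z; rewrite (le_trans (hsum_norm_le _))//= !mulrDl.
rewrite lerD ?(le_trans (ler_normD _ _)) ?lerD//.
- by rewrite (le_trans (aA _))// ler_wpM2l// hsum_norm_fst.
- by rewrite (le_trans (cC _))// ler_wpM2l// hsum_norm_snd.
- by rewrite (le_trans (bB _))// ler_wpM2l// hsum_norm_snd.
Qed.
HB.instance Definition _ := isBoundedOperator.Build K (hsum X Y) (hsum X Y)
  upper_triangular upper_triangular_bounded.

End UpperTriangular.

Section Dimension.
Context (K : fieldType) (V : lmodType K).

(* [basis_mod U W v]: the classes of the vectors v form a basis of the quotient
   space U / W, where W is a linear subspace of the linear subspace U. *)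
Definition basis_mod (U W : set V) (n : nat) (v : 'I_n -> V) : Prop :=
  (forall i, U (v i)) /\
  forall u, U u ->
    exists! c : {ffun 'I_n -> K}, W (u - \sum_(i < n) c i *: v i).

(* The dimension of U / W, equal to +oo when there is no finite basis; see
   [basis_mod_unique] for the independence of the chosen basis. *)
Definition dim_mod (U W : set V) : \bar nat :=
  xget +oo%E [set n%:E | n in [set n | exists v : 'I_n -> V, basis_mod U W v]].

Let basis_mod_le (U W : set V) (m n : nat) (v : 'I_m -> V) (w : 'I_n -> V) :
  submod_closed (mem W) -> basis_mod U W v -> basis_mod U W w -> (m <= n)%N.
Proof.
move=> [/set_mem W0 WP] [Uv vP] [Uw wP].
have WD a x y : W x -> W y -> W (a *: x + y).
  by move=> /mem_set Wx /mem_set Wy; apply/set_mem/WP.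
have Wsum k (a : 'I_k -> K) (x : 'I_k -> V) :
    (forall i, W (x i)) -> W (\sum_i a i *: x i).
  move=> Wx; elim/big_ind: _ => // [y z Wy Wz|i _].
    by rewrite -[y]scale1r; apply: WD.
  by rewrite -[_ *: _]addr0; apply: WD.
have /choice[P PP] j : exists c : {ffun 'I_n -> K},
    W (v j - \sum_i c i *: w i).
  by have [c [Wc _]] := wP _ (Uv j); exists c.
have /choice[Q QP] j : exists c : {ffun 'I_m -> K},
    W (w j - \sum_i c i *: v i).
  by have [c [Wc _]] := vP _ (Uw j); exists c.
pose MP := \matrix_(i, j) P i j; pose MQ := \matrix_(i, j) Q i j.
suff PQ1 : MP *m MQ = 1%:M by exact: mulmx1_min PQ1.
apply/matrixP => i j.
have [c [_ cU]] := vP _ (Uv i).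
have c1 : c = [ffun k => (i == k)%:R].
  apply: cU; rewrite (bigD1 i)//= ffunE eqxx scale1r big1 ?addr0 ?subrr//.
  by move=> k ki; rewrite ffunE eq_sym (negbTE ki) scale0r.
have c2 : c = [ffun k => (MP *m MQ) i k].
  apply: cU.
  have -> : v i - \sum_k [ffun k0 => (MP *m MQ) i k0] k *: v k =
      1 *: (v i - \sum_l P i l *: w l) +
      \sum_l P i l *: (w l - \sum_k Q l k *: v k).
    have -> : \sum_l P i l *: (w l - \sum_k Q l k *: v k) =
        \sum_l P i l *: w l - \sum_l P i l *: (\sum_k Q l k *: v k).
      by rewrite -sumrB; apply: eq_bigr => l _; rewrite scalerBr.
    rewrite scale1r addrA subrK; congr (_ - _).
    under [RHS]eq_bigr do rewrite scaler_sumr.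
    rewrite exchange_big; apply: eq_bigr => k _.
    rewrite ffunE mxE scaler_suml; apply: eq_bigr => l _.
    by rewrite !mxE scalerA.
  by apply: WD => //; apply: Wsum.
by move: c1; rewrite c2 => /ffunP/(_ j); rewrite !ffunE => ->; rewrite mxE.
Qed.

Lemma basis_mod_unique (U W : set V) (m n : nat)
    (v : 'I_m -> V) (w : 'I_n -> V) :
  submod_closed (mem W) -> basis_mod U W v -> basis_mod U W w -> m = n.
Proof.
move=> Wc bv bw; apply/eqP.
by rewrite eqn_leq (basis_mod_le Wc bv bw) (basis_mod_le Wc bw bv).
Qed.

End Dimension.

Section OperatorProperties.
Context (K : numFieldType) (X : normedModType K).
Implicit Type T : 'L(X).

Definition sub_scalar T (lambda : K) : 'L(X) := T \- (lambda \*: idfun).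

Definition kernel T : set X := [set x | T x = 0].

Definition alpha T : \bar nat := dim_mod (kernel T) [set 0].

Definition beta T : \bar nat := dim_mod [set: X] (range T).

Definition invertible T : Prop :=
  exists S : 'L(X), cancel T S /\ cancel S T.

Definition bounded_below T : Prop :=
  exists2 c : K, 0 < c & forall x, c * `|x| <= `|T x|.

Definition surjective T : Prop := range T = [set: X].

Definition quasinilpotent T : Prop :=
  forall lambda : K, lambda != 0 -> invertible (sub_scalar T lambda).

Definition generalized_Drazin_invertible T : Prop :=
  exists S : 'L(X),
    [/\ T \o S =1 S \o T, S \o T \o S =1 S
      & quasinilpotent ((T \o S \o T) \- T)].

Definition semi_regular T : Prop :=
  closed (range T) /\ forall m : nat, kernel T `<=` range (iter m T).

End OperatorProperties.

Definition generalized_Kato_decomposable (K : numFieldType)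
    (X : normedModType K) (T : 'L(X)) : Prop :=
  exists (M N : closedSubspace X) (TM : invariant_subspace T M) (TN : invariant_subspace T N),
    [/\ is_direct_sum M N, semi_regular (restriction TM)
      & quasinilpotent (restriction TN)].

(* Main.v *)
Require Import Defs.
From mathcomp Require Import all_boot all_order all_algebra.
From mathcomp Require Import all_classical all_reals all_analysis.
From mathcomp Require Import complex ring lra.

Set Implicit Arguments.
Unset Strict Implicit.
Unset Printing Implicit Defensive.

Import Order.TTheory GRing.Theory Num.Theory.
Import numFieldNormedType.Exports.

Local Open Scope classical_set_scope.
Local Open Scope ring_scope.
Local Open Scope complex_scope.

(** Write M for the upper triangular operator with entries A, C and 0, B.

    A generalized Drazin inverse S of M splits the space by the projection MS
    into a part on which M is invertible and a part on which M is
    quasinilpotent; hence M - a is bijective for all small a <> 0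
    ([Drazin_punctured_neighborhood], by a Neumann series). For such a, A - a
    is injective and B - a is onto, and y |-> C y induces an isomorphism from
    N(B - a) onto X / R(A - a) ([beta_alpha_shift]); this is the equality of
    the dimensions.

    For the two decompositions, the summands given by the generalized Kato
    decompositions are the required ones. What has to be shown is that a
    semi-regular operator T is bounded below if T - a is injective for all
    small a <> 0 ([semi_regular_bounded_below]), and onto if T - a is onto for
    all small a <> 0 ([semi_regular_surjective]).

    Since R(T) is closed, T has a section g on R(T) with a linear norm bound
    ([closed_range_section], a form of the open mapping theorem). If T x = 0,
    then x lies in the intersection of all R(T^m), and, because N(T) is
    contained in it, any T-preimage of a point of this intersection is again
    in it. So g can be iterated on x, and the series of the a^n g^n(x) converges
    for small a to a vector of N(T - a) close to x ([semi_regular_kernel]).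
    If N(T - a) = 0 this forces x = 0, so T is injective with closed range,
    that is, bounded below. In general one gets preimages under T - a with a
    norm bound uniform in a ([semi_regular_uniform]); and if y = T x_a - a x_a
    with x_a bounded as a tends to 0, then T x_a tends to y, and y is in the
    closed set R(T). *)

(** * Real-valued norms and geometric convergence *)

Section RealNorm.
Context (R : realType).

(** The norm as an element of R. Norms over R[i] take values in R[i], whose
    order is only partial; their imaginary part is 0, so nothing is lost
    ([nrmE]). The scalars themselves are covered too. *)
Definition nrm (V : normedZmodType R[i]) (x : V) : R := complex.Re `|x|.

Lemma nrmE (V : normedZmodType R[i]) (x : V) : `|x| = (nrm x)%:C.
Proof. by rewrite /nrm RRe_real// ger0_real. Qed.

Lemma nrm_ge0 (V : normedZmodType R[i]) (x : V) : 0 <= nrm x.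
Proof. by rewrite -ler0c -nrmE. Qed.

Lemma nrm0 (V : normedZmodType R[i]) : nrm (0 : V) = 0.
Proof. by apply: complexI; rewrite -nrmE normr0. Qed.

Lemma nrm0_eq0 (V : normedZmodType R[i]) (x : V) : nrm x = 0 -> x = 0.
Proof. by move=> x0; apply/normr0_eq0; rewrite nrmE x0. Qed.

Lemma nrm_gt0 (V : normedZmodType R[i]) (x : V) : (0 < nrm x) = (x != 0).
Proof. by rewrite -(ltcR 0) -nrmE normr_gt0. Qed.

Lemma nrmN (V : normedZmodType R[i]) (x : V) : nrm (- x) = nrm x.
Proof. by rewrite /nrm normrN. Qed.

Lemma nrmD (V : normedZmodType R[i]) (x y : V) : nrm (x + y) <= nrm x + nrm y.
Proof. by rewrite -lecR rmorphD /= -!nrmE ler_normD. Qed.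

Lemma nrmB (V : normedZmodType R[i]) (x y : V) : nrm (x - y) <= nrm x + nrm y.
Proof. by rewrite (le_trans (nrmD _ _))// nrmN. Qed.

Lemma nrm_distC (V : normedZmodType R[i]) (x y : V) : nrm (x - y) = nrm (y - x).
Proof. by rewrite /nrm distrC. Qed.

Lemma nrm_distD (V : normedZmodType R[i]) (y x z : V) :
  nrm (x - z) <= nrm (x - y) + nrm (y - z).
Proof. by rewrite -[x in leLHS](subrK y) -addrA nrmD. Qed.

Lemma nrmZ (X : normedModType R[i]) (a : R[i]) (x : X) :
  nrm (a *: x) = nrm a * nrm x.
Proof. by apply: complexI; rewrite -nrmE normrZ !nrmE -rmorphM. Qed.

Lemma nrmX (a : R[i]) (n : nat) : nrm (a ^+ n) = nrm a ^+ n.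
Proof. by apply: complexI; rewrite -nrmE normrX !nrmE -rmorphXn. Qed.

Lemma nrm_real (a : R) : nrm a%:C = `|a|.
Proof.
by apply: complexI; rewrite -nrmE normc_def /= expr0n addr0 sqrtr_sqr.
Qed.

Lemma operator_boundP (X Y : normedModType R[i]) (T : 'L(X, Y)) :
  exists2 c : R, 0 < c & forall x, nrm (T x) <= c * nrm x.
Proof.
have [c c0 cT] := bounded_operatorP T.
have cE : c = (complex.Re c)%:C by rewrite RRe_real ?ger0_real.
have Rc0 : 0 <= complex.Re c by rewrite -ler0c -cE.
exists (complex.Re c + 1); first by rewrite ltr_wpDl.
move=> x; rewrite (@le_trans _ _ (complex.Re c * nrm x))//.
  by rewrite -lecR rmorphM /= -cE -!nrmE.
by rewrite ler_wpM2r ?nrm_ge0// lerDl.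
Qed.

(** A closed set contains the points that it approximates in norm. *)
Lemma closed_nrm (X : normedModType R[i]) (F : set X) (x : X) : closed F ->
  (forall e, 0 < e -> exists2 y, F y & nrm (x - y) < e) -> F x.
Proof.
move=> Fcl Fx; apply: Fcl => B /nbhs_normP[e /= e0 eB].
have eE : e = (complex.Re e)%:C by rewrite RRe_real ?gtr0_real.
have [|y Fy xy] := Fx (complex.Re e); first by rewrite -(ltcR 0) -eE.
by exists y; split => //; apply: eB; rewrite /= nrmE eE ltcR.
Qed.

Lemma half_ge0 : 0 <= (2^-1 : R).
Proof. by []. Qed.

Lemma half_lt1 : (2^-1 : R) < 1.
Proof. by rewrite invf_lt1// ltr1n. Qed.

Lemma geometric_lt (q D e : R) : 0 <= q -> q < 1 -> 0 < e ->
  exists n, D * q ^+ n < e.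
Proof.
move=> q0 q1 e0.
have /cvgrPdist_lt/(_ e e0)[N _ /(_ N (leqnn N))] :
    (fun n => D * q ^+ n) @ \oo --> D * 0.
  by apply: cvgMr; apply: cvg_expr; rewrite ger0_norm.
rewrite /= mulr0 sub0r normrN => h; exists N.
by rewrite (le_lt_trans _ h)// ler_norm.
Qed.

Lemma le0_geometric (q D a : R) : 0 <= q -> q < 1 ->
  (forall n, a <= D * q ^+ n) -> a <= 0.
Proof.
move=> q0 q1 h; rewrite leNgt; apply/negP => a0.
by have [n] := geometric_lt D q0 q1 a0; rewrite ltNge h.
Qed.

(** Completeness in the only form used below: successive differences bounded
    by a geometrically decreasing d give a limit, with an error estimate. *)
Lemma geometric_cvg (X : completeNormedModType R[i]) (u : nat -> X)
    (d : nat -> R) (q : R) : 0 <= q -> q < 1 ->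
  (forall n, d n.+1 <= q * d n) -> (forall n, nrm (u n.+1 - u n) <= d n) ->
  exists l, forall n, nrm (l - u n) <= d n / (1 - q).
Proof.
move=> q0 q1 dq ud.
have q1' : 0 < 1 - q by rewrite subr_gt0.
have tail k n : nrm (u (n + k)%N - u n) <= d n / (1 - q).
  elim: k n => [|k IH] n.
    rewrite addn0 subrr nrm0 divr_ge0 ?(ltW q1')//.
    by rewrite (le_trans _ (ud n))// nrm_ge0.
  rewrite -addSnnS (le_trans (nrm_distD (u n.+1) _ _))//.
  apply: (le_trans (lerD (IH _) (ud n))).
  rewrite ler_pdivlMr// mulrDl divfK ?gt_eqF//.
  by rewrite mulrBr mulr1 mulrC; have := dq n; lra.
have dle n : d n <= d 0%N * q ^+ n.
  elim: n => [|n IH]; first by rewrite expr0 mulr1.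
  by rewrite (le_trans (dq n))// exprS mulrCA ler_wpM2l.
have dsmall e : 0 < e -> exists n, d n / (1 - q) < e.
  move=> e0; have [|n ne] := @geometric_lt q (d 0%N) (e * (1 - q)) q0 q1.
    by rewrite mulr_gt0.
  by exists n; rewrite ltr_pdivrMr// (le_lt_trans (dle n)).
have /cauchy_cvg/cvg_ex[l /cvgrPdist_lt ul] : cauchy (u @ \oo).
  apply: cauchy_exP => e e0.
  have eE : e = (complex.Re e)%:C by rewrite RRe_real ?gtr0_real.
  have [|n ne] := dsmall (complex.Re e); first by rewrite -(ltcR 0) -eE.
  exists (u n), n => // m /= nm.
  rewrite -ball_normE /= nrmE eE ltcR nrm_distC (le_lt_trans _ ne)//.
  by rewrite -(subnKC nm).
exists l => n; apply/ler_addgt0Pr => e e0.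
have [|N _ Nl] := ul e%:C; first by rewrite (ltcR 0).
have := Nl (n + N)%N (leq_addl _ _); rewrite /= nrmE ltcR => /ltW lu.
by rewrite (le_trans (nrm_distD (u (n + N)%N) _ _))// addrC lerD.
Qed.

End RealNorm.

(** * The open mapping theorem for closed ranges *)

Section OpenMapping.
Context (R : realType).

Lemma range_linear (X Y : normedModType R[i]) (T : 'L(X, Y)) (a : R[i])
    (y z : Y) :
  range T y -> range T z -> range T (a *: y + z).
Proof.
by move=> [u _ <-] [v _ <-]; exists (a *: u + v) => //; rewrite linearP.
Qed.

(** Baire category argument in the complete space R(T): the closure of the
    image of some ball of radius n contains a ball of R(T). *)
Lemma closed_range_ball (X : normedModType R[i])
    (Y : completeNormedModType R[i]) (T : 'L(X, Y)) : closed (range T) ->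
  exists (n : nat) (y0 : Y) (r : R), [/\ 0 < r, range T y0 &
    forall y, range T y -> nrm (y - y0) < r ->
    forall e, 0 < e -> exists2 x, nrm x <= n%:R & nrm (T x - y) < e].
Proof.
move=> Tcl; apply: contrapT => noball.
(* Otherwise every ball of R(T), of centre y0 and radius r, contains a point
   z.1 of R(T) at distance at least z.2 > 0 from the image of the n-ball. *)
have step (p : nat * Y * R) : exists z : Y * R, range T p.1.2 -> 0 < p.2 ->
    [/\ range T z.1, nrm (z.1 - p.1.2) < p.2, 0 < z.2 &
      forall x, nrm x <= p.1.1%:R -> z.2 <= nrm (T x - z.1)].
  case: p => [[n y0] r] /=.
  have [[Ty0 r0]|h] := pselect (range T y0 /\ 0 < r); last first.
    by exists (0, 0) => h1 h2; case: h.
  apply: contrapT => noz; apply: noball.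
  exists n, y0, r; split => // y Ty yr e e0.
  apply: contrapT => nox; apply: noz; exists (y, e) => _ _; split => //= x xn.
  by rewrite leNgt; apply/negP => h; apply: nox; exists x.
have [g gP] := choice step.
(* The balls of centre (s n).1 and radius (s n).2 are nested, and the one of
   index n.+1 is disjoint from the image of the n-ball. *)
pose s := fix s n : Y * R := if n is m.+1 then
  let z := g (m, (s m).1, (s m).2 / 2) in (z.1, Num.min ((s m).2 / 2) (z.2 / 2))
  else (0, 1).
have sinv n : range T (s n).1 /\ 0 < (s n).2.
  elim: n => [|n [Tn rn]] /=; first by split; [exists 0; rewrite ?linear0|].
  have [//||Tz _ z0 _] := gP (n, (s n).1, (s n).2 / 2) => /=.
    by rewrite divr_gt0.
  by split => //; rewrite lt_min !divr_gt0.
have sS n : [/\ nrm ((s n.+1).1 - (s n).1) <= (s n).2 / 2,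
    (s n.+1).2 <= (s n).2 / 2 & forall x, nrm x <= n%:R ->
      (s n.+1).2 < nrm (T x - (s n.+1).1)].
  have [Tn rn] := sinv n.
  have [//||_ /= zr z0 zx] := gP (n, (s n).1, (s n).2 / 2) => /=.
    by rewrite divr_gt0.
  split; [exact: ltW|by rewrite ge_min lexx|].
  move=> x /zx; apply: lt_le_trans; rewrite gt_min; apply/orP; right.
  by rewrite ltr_pdivrMr// ltr_pMr// ltr1n.
have [|n|l lP] := @geometric_cvg R Y (fun n => (s n).1)
    (fun n => (s n).2 / 2) 2^-1 (half_ge0 R) (half_lt1 R).
- by move=> n; have [_ h _] := sS n; rewrite mulrC ler_pM2l// invr_gt0.
- by have [h _ _] := sS n.
have ls n : nrm (l - (s n).1) <= (s n).2.
  rewrite (le_trans (lP n))//.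
  have -> : (1 - 2^-1 : R) = 2^-1 by field.
  by rewrite invrK divfK.
have s2 n : (s n).2 <= 1 * 2^-1 ^+ n.
  elim: n => [|n IH]; first by rewrite expr0 mulr1.
  have [_ h _] := sS n; rewrite (le_trans h)// exprSr mulrA.
  by rewrite ler_pM2r// invr_gt0.
have [x _ Tx] : range T l.
  apply: closed_nrm => // e e0.
  have [n ne] := geometric_lt 1 (half_ge0 R) (half_lt1 R) e0.
  exists (s n).1; first by have [] := sinv n.
  by rewrite (le_lt_trans (ls n))// (le_lt_trans (s2 n)).
have xn : nrm x <= (Num.bound (nrm x))%:R.
  by rewrite ltW// archi_boundP ?nrm_ge0.
have [_ _ /(_ x xn)] := sS (Num.bound (nrm x)).
by rewrite Tx ltNge ls.
Qed.

(** Every y in R(T) is a limit of images of vectors of norm at most K |y|. *)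
Lemma closed_range_dense (X : normedModType R[i])
    (Y : completeNormedModType R[i]) (T : 'L(X, Y)) : closed (range T) ->
  exists2 K : R, 0 < K & forall y, range T y -> forall e, 0 < e ->
    exists2 x, nrm x <= K * nrm y & nrm (T x - y) < e.
Proof.
move=> /closed_range_ball[n [y0 [r [r0 Ty0 ball]]]].
have K0 : 0 < 4 * (n%:R + 1) / r by rewrite divr_gt0// mulr_gt0// ltr_wpDl.
exists (4 * (n%:R + 1) / r) => // y Ty e e0.
have [->|yN0] := eqVneq y 0.
  exists 0; first by rewrite !nrm0 mulr0.
  by rewrite subr0 linear0 nrm0.
have ny0 : 0 < nrm y by rewrite nrm_gt0.
pose t := r / (2 * nrm y).
have t0 : 0 < t by rewrite divr_gt0// mulr_gt0.
have tC : t%:C != 0 by rewrite -nrm_gt0 nrm_real normr_gt0 gt_eqF.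
have te0 : 0 < t * e / 2 by rewrite divr_gt0// mulr_gt0.
(* A small multiple of y is a difference of two points of the ball. *)
have [||u un uy] := ball (t%:C *: y + y0) _ _ _ te0.
- exact: range_linear.
- rewrite addrK nrmZ nrm_real gtr0_norm// /t invfM mulrA mulfVK ?gt_eqF//.
  by rewrite ltr_pdivrMr// ltr_pMr// ltr1n.
have [||v vn vy] := ball y0 _ _ _ te0 => //; first by rewrite subrr nrm0.
exists (t%:C^-1 *: (u - v)).
  rewrite -fmorphV nrmZ nrm_real gtr0_norm ?invr_gt0//.
  have -> : 4 * (n%:R + 1) / r * nrm y = t^-1 * (2 * (n%:R + 1)).
    by rewrite /t; field; rewrite !gt_eqF.
  by rewrite ler_pM2l ?invr_gt0// (le_trans (nrmB _ _))//; lra.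
rewrite linearZ linearB /=.
have -> : t%:C^-1 *: (T u - T v) - y =
    t%:C^-1 *: ((T u - (t%:C *: y + y0)) - (T v - y0)).
  rewrite -[y in LHS](scalerK tC) -scalerBr; congr (_ *: _).
  by rewrite opprB opprD !addrA subrK addrAC.
rewrite -fmorphV nrmZ nrm_real gtr0_norm ?invr_gt0// mulrC ltr_pdivrMr//.
by rewrite (le_lt_trans (nrmB _ _))// [e * t]mulrC [ltRHS]splitr ltrD.
Qed.

(** Open mapping theorem: T has a right inverse g on its closed range,
    not linear in general, with |g y| <= K |y|. The values of g outside R(T)
    are irrelevant. *)
Lemma closed_range_section (X Y : completeNormedModType R[i]) (T : 'L(X, Y)) :
  closed (range T) -> exists (K : R) (g : Y -> X), 0 < K /\
    forall y, range T y -> T (g y) = y /\ nrm (g y) <= K * nrm y.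
Proof.
move=> /closed_range_dense[K K0 dense].
have /choice[h hP] y : exists x, range T y ->
    nrm x <= K * nrm y /\ nrm (T x - y) <= 2^-1 * nrm y.
  have [Ty|nTy] := pselect (range T y); last by exists 0.
  have [->|yN0] := eqVneq y 0.
    by exists 0 => _; rewrite linear0 subrr !nrm0 !mulr0.
  have [|x xy /ltW Txy] := dense y Ty (2^-1 * nrm y).
    by rewrite mulr_gt0 ?invr_gt0// nrm_gt0.
  by exists x.
have [c c0 cT] := operator_boundP T.
suff : forall y, exists x, range T y -> T x = y /\ nrm x <= (2 * K) * nrm y.
  by move=> /choice[g gP]; exists (2 * K), g; split => //; rewrite mulr_gt0.
move=> y; have [Ty|nTy] := pselect (range T y); last by exists 0.
(* Successive approximation: (s n).1 is an approximate preimage of y, and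
   (s n).2 the remainder, at least halved at each step. *)
pose s := fix s n : X * Y := if n is m.+1 then
  ((s m).1 + h (s m).2, (s m).2 - T (h (s m).2)) else (0, y).
have sinv n : range T (s n).2 /\ T (s n).1 + (s n).2 = y.
  elim: n => [|n [Tn yn]] /=; first by rewrite linear0 add0r.
  split; last by rewrite linearD addrACA subrr addr0.
  rewrite addrC -scaleN1r; apply: range_linear; last by [].
  by exists (h (s n).2).
have s2S n : nrm (s n.+1).2 <= 2^-1 * nrm (s n).2.
  by have [/hP[_]] := sinv n; rewrite nrm_distC.
have s2 n : nrm (s n).2 <= nrm y * 2^-1 ^+ n.
  elim: n => [|n IH]; first by rewrite expr0 mulr1.
  by rewrite (le_trans (s2S n))// exprS mulrCA ler_wpM2l.
have [||l lP] := @geometric_cvg R X (fun n => (s n).1)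
    (fun n => K * nrm (s n).2) 2^-1 (half_ge0 R) (half_lt1 R).
- by move=> n; rewrite mulrCA ler_wpM2l// ltW.
- by move=> n; have [/hP[hK _] _] := sinv n; rewrite /= addrAC subrr add0r.
have ls n : nrm (l - (s n).1) <= 2 * K * nrm (s n).2.
  rewrite (le_trans (lP n))//.
  have -> : (1 - 2^-1 : R) = 2^-1 by field.
  by rewrite invrK mulrC mulrA.
exists l => _; split; last by have := ls 0%N; rewrite /= subr0.
apply/eqP; rewrite -subr_eq0; apply/eqP/nrm0_eq0/le_anti; rewrite nrm_ge0 andbT.
apply: (@le0_geometric R 2^-1 ((c * (2 * K) + 1) * nrm y)) => // [|n].
  exact: half_lt1.
have [_ yn] := sinv n.
have -> : T l - y = T (l - (s n).1) - (s n).2.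
  by rewrite linearB /= -addrA -opprD yn.
rewrite (le_trans (nrmB _ _))// -mulrA.
rewrite (@le_trans _ _ ((c * (2 * K) + 1) * nrm (s n).2))//.
  by rewrite mulrDl mul1r lerD2r (le_trans (cT _))// -mulrA ler_pM2l.
by rewrite ler_pM2l// addr_gt0// !mulr_gt0.
Qed.

End OpenMapping.

(** * Semi-regular operators under small shifts *)

Section SemiRegular.
Context (R : realType).

Lemma iter_linearD (X : normedModType R[i]) (T : 'L(X)) m (x y : X) :
  iter m T (x + y) = iter m T x + iter m T y.
Proof. by elim: m => //= m ->; rewrite linearD. Qed.

(** A vector x of N(T) is close to a vector of N(T - a), for small a: the sum
    of the series of the a^n g^n(x). *)
Lemma semi_regular_kernel (X : completeNormedModType R[i]) (T : 'L(X)) (K : R)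
    (g : X -> X) : semi_regular T -> 0 < K ->
  (forall y, range T y -> T (g y) = y /\ nrm (g y) <= K * nrm y) ->
  forall (a : R[i]) (x : X), K * nrm a <= 2^-1 -> T x = 0 ->
  exists2 z, T z = a *: z & nrm (z - x) <= 2 * (K * nrm a) * nrm x.
Proof.
move=> [_ NR] K0 gP a x0.
set q := K * nrm a => q_half Tx0.
have q0 : 0 <= q by rewrite mulr_ge0 ?nrm_ge0 ?ltW.
have q1 : q < 1 by exact: le_lt_trans q_half (half_lt1 R).
have q1' : 0 < 1 - q by rewrite subr_gt0.
pose x n := iter n g x0.
(* If T u is in R(T^(m+1)), then u differs from a point of R(T^m) by an
   element of N(T), which is contained in R(T^m). *)
have xR n : forall m, range (iter m T) (x n).
  elim: n => [|n IH] m; first exact: NR.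
  have [z _ zx] := IH m.+1.
  have [Tg _] := gP (x n) (IH 1%N).
  have ker : T (x n.+1 - iter m T z) = 0.
    by rewrite linearB [X in X - _]Tg [X in _ - X]zx subrr.
  have [w _ wE] := NR m _ ker.
  by exists (w + z) => //; rewrite iter_linearD wE subrK.
have TxS n : T (x n.+1) = x n by have [] := gP (x n) (xR n 1%N).
have nx n : nrm (x n) <= K ^+ n * nrm x0.
  elim: n => [|n IH]; first by rewrite expr0 mul1r.
  have [_ h] := gP (x n) (xR n 1%N); rewrite (le_trans h)//.
  by rewrite exprS -mulrA ler_pM2l.
have nax n : nrm (a ^+ n *: x n) <= q ^+ n * nrm x0.
  rewrite nrmZ nrmX exprMn mulrAC mulrC ler_wpM2r ?exprn_ge0 ?nrm_ge0//.
have xE0 : x 0%N = x0 by [].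
clearbody x.
pose s n := \sum_(k < n.+1) a ^+ k *: x k.
have sS n : s n.+1 - s n = a ^+ n.+1 *: x n.+1.
  by rewrite {1}/s big_ord_recr /= -/(s n) addrAC subrr add0r.
have s0 : s 0%N = x0 by rewrite /s big_ord1 expr0 scale1r xE0.
have [||l lP] := @geometric_cvg R X s (fun n => q ^+ n.+1 * nrm x0) q q0 q1.
- by move=> n; rewrite [in leLHS]exprS mulrA.
- by move=> n; rewrite sS.
have Ts n : T (s n) - a *: s n = - (a ^+ n.+1 *: x n).
  elim: n => [|n IH]; first by rewrite s0 xE0 Tx0 sub0r expr1.
  have -> : s n.+1 = s n + a ^+ n.+1 *: x n.+1 by rewrite -sS addrC subrK.
  have TaS : T (a ^+ n.+1 *: x n.+1) = a ^+ n.+1 *: x n.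
    by rewrite linearZ /= TxS.
  rewrite linearD /= TaS scalerDr opprD addrACA IH scalerA -exprS.
  by rewrite addrA addNr sub0r.
have [c c0 cT] := operator_boundP T.
exists l; last first.
  have := lP 0%N; rewrite s0 expr1 => /le_trans; apply.
  rewrite ler_pdivrMr//.
  have := mulr_ge0 q0 (nrm_ge0 x0); nra.
apply/eqP; rewrite -subr_eq0; apply/eqP/nrm0_eq0/le_anti; rewrite nrm_ge0 andbT.
apply: (@le0_geometric R q ((c + nrm a) * (q * nrm x0 / (1 - q)) +
  nrm a * nrm x0)) => // n.
have -> : T l - a *: l = (T (l - s n) - a *: (l - s n)) + (T (s n) - a *: s n).
  by rewrite linearB /= scalerBr opprB addrACA subrK addrAC subrr add0r.
rewrite (le_trans (nrmD _ _))// Ts nrmN mulrDl lerD//; last first.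
  by rewrite exprS -scalerA nrmZ -mulrA ler_wpM2l ?nrm_ge0// mulrC.
rewrite (le_trans (nrmB _ _))// nrmZ.
have lq : nrm (l - s n) <= q * nrm x0 / (1 - q) * q ^+ n.
  have -> : q * nrm x0 / (1 - q) * q ^+ n = q ^+ n.+1 * nrm x0 / (1 - q).
    by rewrite exprS; ring.
  exact: lP.
rewrite (@le_trans _ _ ((c + nrm a) * nrm (l - s n)))//.
  by rewrite mulrDl lerD2r.
by rewrite -mulrA ler_wpM2l// addr_ge0 ?nrm_ge0 ?ltW.
Qed.

Lemma exists_small (d K M e : R) : 0 < d -> 0 < K -> 0 <= M -> 0 < e ->
  exists a : R, [/\ 0 < a, a < d, K * a <= 8^-1 & M * a < e].
Proof.
move=> d0 K0 M0 e0.
pose a := Num.min (d / 2) (Num.min (8^-1 / K) (e / (M + 1))).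
have M1 : 0 < M + 1 by rewrite ltr_wpDl.
have a0 : 0 < a by rewrite !lt_min !divr_gt0.
have ad : a <= d / 2 by rewrite ge_min lexx.
have aK : a <= 8^-1 / K by rewrite !ge_min lexx orbT.
have aM : a <= e / (M + 1) by rewrite !ge_min lexx !orbT.
exists a; split => //.
- by rewrite (le_lt_trans ad)// ltr_pdivrMr// ltr_pMr// ltr1n.
- by rewrite mulrC -ler_pdivlMr.
- move: aM; rewrite ler_pdivlMr// => aM.
  by rewrite (lt_le_trans _ aM)// mulrDr mulr1 mulrC ltrDl.
Qed.

Lemma semi_regular_bounded_below (X : completeNormedModType R[i]) (T : 'L(X))
    (d : R) :
  semi_regular T -> 0 < d ->
  (forall a, 0 < nrm a < d -> forall x, T x = a *: x -> x = 0) ->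
  bounded_below T.
Proof.
move=> Tsr d0 inj; have [K [g [K0 gP]]] := closed_range_section (proj1 Tsr).
have [a [a0 ad Ka _]] := exists_small d0 K0 (lexx 0) ltr01.
have na : nrm a%:C = a by rewrite nrm_real gtr0_norm.
have ker0 x : T x = 0 -> x = 0.
  move=> Tx0.
  have [|z Tz zx] := semi_regular_kernel Tsr K0 gP (a := a%:C) _ Tx0.
    by rewrite na; lra.
  move: zx; rewrite (inj _ _ _ Tz) ?na ?a0// sub0r nrmN => xq.
  apply/nrm0_eq0/le_anti; rewrite nrm_ge0 andbT.
  by have := nrm_ge0 x; nra.
exists (K^-1)%:C; first by rewrite (ltcR 0) invr_gt0.
move=> x; have [|Tg gK] := gP (T x); first by exists x.
have <- : g (T x) = x.
  by apply/eqP; rewrite -subr_eq0; apply/eqP/ker0; rewrite linearB /= Tg subrr.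
by rewrite Tg !nrmE -rmorphM /= lecR mulrC ler_pdivrMr// mulrC.
Qed.

(** For small a, every vector of R(T - a) has a preimage bounded by its norm,
    with a constant independent of a. *)
Lemma semi_regular_uniform (X : completeNormedModType R[i]) (T : 'L(X)) :
  semi_regular T -> exists2 K : R, 0 < K & forall a, K * nrm a <= 8^-1 ->
    forall x, exists2 x', T x' - a *: x' = T x - a *: x &
      nrm x' <= 5 * K * nrm (T x - a *: x).
Proof.
move=> Tsr; have [K [g [K0 gP]]] := closed_range_section (proj1 Tsr).
exists K => // a; set q := K * nrm a => q8 x; set w := T x - a *: x.
have q0 : 0 <= q by rewrite mulr_ge0 ?nrm_ge0 ?ltW.
have [w0|wN0] := eqVneq w 0.
  by exists 0; rewrite w0; [rewrite linear0 scaler0 subrr|rewrite !nrm0 mulr0].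
(* Subtract from u an element of N(T - a) close to the element u - g (T u)
   of N(T). *)
have step u : T u - a *: u = w -> exists2 v, T v - a *: v = w &
    nrm v <= 2 * K * nrm w + 2^-1 * nrm u.
  move=> uw; have [|Tg gK] := gP (T u); first by exists u.
  have Tgu : T (u - g (T u)) = 0 by rewrite linearB /= Tg subrr.
  have [|z Tz zx] := semi_regular_kernel Tsr K0 gP (a := a) _ Tgu.
    by rewrite -/q; lra.
  exists (u - z).
    by rewrite linearB /= Tz scalerBr opprB addrA subrK uw.
  have gT : nrm (g (T u)) <= K * nrm w + q * nrm u.
    rewrite (le_trans gK)// /q -mulrA -mulrDr ler_pM2l// -nrmZ.
    by rewrite -uw (le_trans _ (nrmD _ _))// subrK.
  have nB : nrm (u - g (T u)) <= nrm u + nrm (g (T u)) := nrmB _ _.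
  have zB : nrm (u - z) <= nrm (g (T u)) + nrm (z - (u - g (T u))).
    have -> : u - z = g (T u) - (z - (u - g (T u))).
      by rewrite opprB addrA [_ + (u - _)]addrC subrK.
    exact: nrmB.
  have qr (r : R) : 0 <= r -> q * r <= 8^-1 * r by move=> r0; exact: ler_wpM2r.
  have := qr _ (nrm_ge0 u); have := qr _ (nrm_ge0 (u - g (T u))).
  have Kw : 0 <= K * nrm w by rewrite mulr_ge0 ?nrm_ge0// ltW.
  have := nrm_ge0 u; move: zx; rewrite -/q; lra.
(* Once the term in |x| is below K |w|, the bound is (4 + 1) K |w|. *)
have iterate n : exists2 v, T v - a *: v = w &
    nrm v <= 4 * K * nrm w + nrm x * 2^-1 ^+ n.
  elim: n => [|n [v vw nv]].
    by exists x; rewrite // expr0 mulr1 lerDr !mulr_ge0 ?nrm_ge0// ltW.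
  have [v' v'w nv'] := step v vw; exists v' => //.
  by rewrite (le_trans nv')// exprS; lra.
have [|n nw] := geometric_lt (nrm x) (half_ge0 R) (half_lt1 R) (e := K * nrm w).
  by rewrite mulr_gt0// nrm_gt0.
by have [v vw nv] := iterate n; exists v => //; lra.
Qed.

Lemma semi_regular_surjective (X : completeNormedModType R[i]) (T : 'L(X))
    (d : R) :
  semi_regular T -> 0 < d ->
  (forall a, 0 < nrm a < d -> forall y, exists x, T x - a *: x = y) ->
  surjective T.
Proof.
move=> Tsr d0 surj; have [K K0 unif] := semi_regular_uniform Tsr.
rewrite /surjective -subTset => y _.
apply: closed_nrm => [|e e0]; first by case: Tsr.
have M0 : 0 <= 5 * K * nrm y by rewrite !mulr_ge0 ?nrm_ge0// ltW.
have [a [a0 ad Ka aM]] := exists_small d0 K0 M0 e0.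
have na : nrm a%:C = a by rewrite nrm_real gtr0_norm.
have [|x xy] := surj a%:C _ y; first by rewrite na a0.
have [|x' x'y nx'] := unif a%:C _ x; first by rewrite na.
exists (T x'); first by exists x'.
rewrite xy in x'y nx'.
have -> : y - T x' = - (a%:C *: x') by rewrite -x'y addrAC subrr sub0r.
by rewrite nrmN nrmZ na (le_lt_trans _ aM)// mulrC ler_pM2r.
Qed.

End SemiRegular.

(** * Small shifts of generalized Drazin invertible operators *)

Section DrazinShift.
Context (R : realType).

(** 1 - a S is bijective if c is a norm bound of S and |a| c <= 1/2. *)
Lemma neumann_bijective (X : completeNormedModType R[i]) (S : 'L(X)) (c : R)
    (a : R[i]) :
  (forall x, nrm (S x) <= c * nrm x) -> nrm a * c <= 2^-1 ->
  (forall x, x = a *: S x -> x = 0) /\ (forall y, exists x, x - a *: S x = y).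
Proof.
move=> cS ac.
have aS x : nrm (a *: S x) <= 2^-1 * nrm x.
  rewrite nrmZ (@le_trans _ _ (nrm a * (c * nrm x)))//.
    by rewrite ler_wpM2l ?nrm_ge0.
  by rewrite mulrA ler_wpM2r ?nrm_ge0.
split=> [x xE|y].
  apply/nrm0_eq0/le_anti; rewrite nrm_ge0 andbT.
  by have := aS x; rewrite -xE; have := nrm_ge0 x; lra.
pose s := fix s n := if n is m.+1 then y + a *: S (s m) else y.
have sS n : nrm (s n.+1 - s n) <= nrm y * 2^-1 ^+ n.
  elim: n => [|n IH].
    rewrite /= addrAC subrr add0r expr0 mulr1 (le_trans (aS _))//.
    by have := nrm_ge0 y; lra.
  have -> : s n.+2 - s n.+1 = a *: S (s n.+1 - s n).
    rewrite linearB scalerBr [s n.+2]/= [s n.+1 in X in _ - X]/=.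
    by rewrite opprD addrACA subrr add0r.
  by rewrite (le_trans (aS _))// exprS mulrCA ler_pM2l// invr_gt0.
have [||l lP] := @geometric_cvg R X s (fun n => nrm y * 2^-1 ^+ n) _
    (half_ge0 R) (half_lt1 R).
- by move=> n; rewrite exprS mulrCA.
- exact: sS.
exists l; apply/eqP; rewrite -subr_eq0; apply/eqP/nrm0_eq0/le_anti.
rewrite nrm_ge0 andbT.
apply: (@le0_geometric R 2^-1 (2 * (2 * nrm y))) => // [|n].
  exact: half_lt1.
have -> : l - a *: S l - y = (l - s n.+1) - a *: S (l - s n).
  rewrite linearB scalerBr /= opprB opprD !addrA subrK.
  by rewrite addrAC.
have := lP n; have := lP n.+1; have := aS (l - s n).
have := nrmB (l - s n.+1) (a *: S (l - s n)).
have -> : (1 - 2^-1 : R) = 2^-1 by field.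
rewrite exprS invrK; have := mulr_ge0 (nrm_ge0 y) (exprn_ge0 n (half_ge0 R)).
lra.
Qed.

(** T - a is bijective for small a <> 0: on the range of T S it is T (1 - a S),
    and on the kernel of T S it is - (Q + a), where Q = T S T - T. *)
Lemma Drazin_punctured_neighborhood (X : completeNormedModType R[i])
    (T : 'L(X)) :
  generalized_Drazin_invertible T ->
  exists2 d : R, 0 < d & forall a, 0 < nrm a < d ->
    (forall x, T x = a *: x -> x = 0) /\ (forall y, exists x, T x - a *: x = y).
Proof.
move=> [S [TS STS QN]]; have [c c0 cS] := operator_boundP S.
have {}TS x : T (S x) = S (T x) by exact: TS.
have {}STS x : S (T (S x)) = S x by exact: STS.
have d0 : 0 < (2 * c)^-1 by rewrite invr_gt0 mulr_gt0.
exists (2 * c)^-1 => // a /andP[a0 ad].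
have aN0 : a != 0 by rewrite -nrm_gt0.
have [|inj surj] := @neumann_bijective X S c a cS.
  move: ad; rewrite invfM ltr_pdivlMr// => /ltW; exact.
pose Q x := T (S (T x)) - T x.
have QaE x : sub_scalar (T \o S \o T \- T) (- a) x = Q x + a *: x.
  by rewrite /= scaleNr opprK.
have [|V [VK KV]] := QN (- a); first by rewrite oppr_eq0.
split=> [x Tx|y].
  have Sx0 : S x = 0.
    by apply: inj; rewrite -[LHS]STS TS Tx !linearZ.
  have Qx0 : Q x + a *: x = 0 by rewrite /Q -TS Sx0 !linear0 Tx sub0r addNr.
  by rewrite -[x]VK QaE Qx0 linear0.
(* v solves (T - a) v = T S y, and z solves (T - a) z = y - T S y. *)
have [v vE] := surj (S y).
have vE' : v = a *: S v + S y by rewrite -vE addrC subrK.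
have TSv : T (S v) = v.
  rewrite [in LHS]vE' !linearD !linearZ /=.
  by rewrite [T (S (S v))]TS [T (S (S y))]TS !STS -vE'.
have Tv : T v - a *: v = T (S y).
  by rewrite -[in a *: v]TSv -vE linearB [X in _ = _ - X]linearZ.
pose z := V (- (y - T (S y))).
have zE : Q z + a *: z = - (y - T (S y)) by rewrite -QaE KV.
have TSz0 : T (S z) = 0.
  have : T (S (Q z + a *: z)) = 0.
    by rewrite zE opprB !linearB /= STS subrr.
  rewrite /Q !linearD !linearN /= STS subrr add0r !linearZ /=.
  by move/eqP; rewrite scaler_eq0 (negbTE aN0) => /eqP.
have Tz : T z = - Q z by rewrite /Q -TS TSz0 linear0 sub0r opprK.
exists (v + z); rewrite linearD /= scalerDr opprD addrACA Tv Tz -opprD zE opprK.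
by rewrite addrC subrK.
Qed.

End DrazinShift.

(** * Dimensions of quotients *)

Section QuotientDimension.
Context (K : fieldType).

(** A linear map f which induces an isomorphism from U' / W' onto U / W
    preserves the dimension, finite or not. *)
Lemma dim_mod_iso (V V' : lmodType K) (f : {linear V' -> V}) (U W : set V)
    (U' W' : set V') : submod_closed (mem U') -> submod_closed (mem W) ->
  (forall u, U' u -> U (f u)) -> (forall u, U' u -> (W (f u) <-> W' u)) ->
  (forall u, U u -> exists2 u', U' u' & W (u - f u')) ->
  dim_mod U W = dim_mod U' W'.
Proof.
move=> [/set_mem U'0 U'P] [/set_mem W0 WP] fU fW fsurj.
have WD x y : W x -> W y -> W (x + y).
  by move=> /mem_set Wx /mem_set Wy; rewrite -[x]scale1r; apply/set_mem/WP.
have WB x y : W x -> W y -> W (x - y).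
  move=> Wx Wy; apply: WD => //; rewrite -[- y]addr0 -scaleN1r.
  by apply/set_mem/WP; exact/mem_set.
have U'D x y : U' x -> U' y -> U' (x + y).
  by move=> /mem_set Wx /mem_set Wy; rewrite -[x]scale1r; apply/set_mem/U'P.
have U'Z a x : U' x -> U' (a *: x).
  move=> /mem_set Ux; rewrite -[_ *: _]addr0.
  by apply/set_mem/U'P => //; exact/mem_set.
have U'comb n (c : 'I_n -> K) (v : 'I_n -> V') u :
    U' u -> (forall i, U' (v i)) -> U' (u - \sum_i c i *: v i).
  move=> Uu Uv; apply: (U'D) => //; rewrite -scaleN1r; apply: (U'Z).
  by apply: (big_ind U') => // i _; exact: U'Z.
have Wcomb n (c : 'I_n -> K) (v : 'I_n -> V) : (forall i, W (v i)) ->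
    W (\sum_i c i *: v i).
  move=> Wv; apply: (big_ind W) => // i _.
  by rewrite -[_ *: _]addr0; apply/set_mem/WP; exact/mem_set.
have transfer n (v : 'I_n -> V) (w : 'I_n -> V') u u' (c : {ffun 'I_n -> K}) :
    (forall i, U' (w i)) -> (forall i, W (v i - f (w i))) -> U' u' ->
    W (u - f u') -> W (u - \sum_i c i *: v i) <-> W' (u' - \sum_i c i *: w i).
  move=> Uw Wvw Uu' Wu; rewrite -fW; last exact: U'comb.
  (* The two combinations differ by an element of W. *)
  have -> : f (u' - \sum_i c i *: w i) = u - \sum_i c i *: v i
      - ((u - f u') - \sum_i c i *: (v i - f (w i))).
    rewrite linearB linear_sum; under eq_bigr do rewrite linearZ.
    under [X in _ = _ - (_ - X)]eq_bigr do rewrite scalerBr.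
    rewrite sumrB /=; set p := \sum_i _ *: f _; set q := \sum_i _ *: v _.
    by rewrite !opprB !addrA subrK [u - p]addrC [RHS]addrAC addrK [RHS]addrC.
  have Wr : W (u - f u' - \sum_i c i *: (v i - f (w i))).
    by apply: WB => //; exact: Wcomb.
  split=> [Wc|Wc]; first exact: WB.
  by have := WD _ _ Wc Wr; rewrite subrK.
rewrite /dim_mod; congr (xget _ [set _ | _ in _]).
apply/seteqP; split=> n /= [v [Uv vP]].
  have /choice[w wP] i : exists x, U' x /\ W (v i - f x).
    by have [x] := fsurj _ (Uv i); exists x.
  have Uw i : U' (w i) by have [] := wP i.
  have Wvw i : W (v i - f (w i)) by have [] := wP i.
  exists w; split=> // u' Uu'.
  have [c [Wc cU]] := vP _ (fU _ Uu').
  have tr c' := transfer _ v w (f u') u' c' Uw Wvw Uu'.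
  have W0' : W (f u' - f u') by rewrite subrr.
  exists c; split; first exact/(tr c W0').
  by move=> c' /(tr c' W0')/cU.
pose w i := f (v i).
have Wvw i : W (w i - f (v i)) by rewrite subrr.
exists w; split=> [i|u Uu]; first exact: fU.
have [u' Uu' Wu] := fsurj _ Uu.
have [c [Wc cU]] := vP _ Uu'.
have tr c' := transfer _ w v u u' c' Uv Wvw Uu' Wu.
exists c; split; first exact/tr.
by move=> c' /tr/cU.
Qed.

End QuotientDimension.

(** * Upper triangular operators and their diagonal entries *)

Section UpperTriangularShift.
Context (R : realType).

Lemma submod_closed_kernel (X Y : normedModType R[i]) (T : 'L(X, Y)) :
  submod_closed (mem [set x | T x = 0]).
Proof.
split=> [|a x y /set_mem /= Tx /set_mem /= Ty]; apply/mem_set => /=.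
  by rewrite linear0.
by rewrite linearP /= Tx Ty scaler0 addr0.
Qed.

Lemma submod_closed_range (X Y : normedModType R[i]) (T : 'L(X, Y)) :
  submod_closed (mem (range T)).
Proof.
split=> [|a x y /set_mem Tx /set_mem Ty]; apply/mem_set.
  by exists 0; rewrite ?linear0.
exact: range_linear.
Qed.

Section Shift.
Context (X Y : normedModType R[i]) (A : 'L(X)) (B : 'L(Y)) (C : 'L(Y, X))
  (a : R[i])
  (inj : forall z : hsum X Y, upper_triangular A B C z = a *: z -> z = 0)
  (surj : forall z : hsum X Y, exists t : hsum X Y,
    upper_triangular A B C t - a *: t = z).

Lemma upper_triangular_inj x : A x = a *: x -> x = 0.
Proof.
move=> Ax; have : ((x, 0) : hsum X Y) = 0.
  apply: inj; rewrite /upper_triangular /= !linear0 addr0 Ax.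
  by congr pair; rewrite /= scaler0.
by case.
Qed.

Lemma upper_triangular_surj y : exists v, B v - a *: v = y.
Proof. by have [[u v] h] := surj (0, y); exists v; exact: (congr1 snd h). Qed.

(** If M - a is bijective, y |-> C y induces an isomorphism from N(B - a) onto
    X / R(A - a): for y in N(B - a), C y = (A - a) x means that (- x, y) is in
    N(M - a), and a solution of (M - a)(u, y) = (x, 0) gives y with
    x - C y = (A - a) u. *)
Lemma beta_alpha_shift : beta (sub_scalar A a) = alpha (sub_scalar B a).
Proof.
apply: (@dim_mod_iso _ _ _ C).
- exact: submod_closed_kernel.
- exact: submod_closed_range.
- by [].
- move=> y /= By; split=> [[x _ /= xC]|->]; last first.
    exists 0 => //.
    by rewrite /= !linear0 addr0.
  have : ((- x, y) : hsum X Y) = 0.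
    apply: inj; rewrite /upper_triangular /= -xC linearN addrA addNr sub0r.
    congr pair; first by rewrite /= scalerN.
    by apply/eqP; rewrite -subr_eq0; apply/eqP.
  by case.
- move=> x _; have [[u y] h] := surj (x, 0).
  have ux : A u + C y - a *: u = x := congr1 fst h.
  have yx : B y - a *: y = 0 := congr1 snd h.
  exists y => //; exists u => //=.
  by rewrite -ux addrAC addrK.
Qed.

End Shift.
End UpperTriangularShift.

(** If T - a is onto, so is its restriction to a summand of an invariant direct
    sum decomposition. *)
Lemma restriction_shift_surjective (K : numFieldType) (X : normedModType K)
    (T : 'L(X)) (M N : closedSubspace X) (TM : invariant_subspace T M) (a : K) :
  invariant_subspace T N -> is_direct_sum M N ->
  (forall y, exists x, T x - a *: x = y) ->
  forall y, exists x, restriction TM x - a *: x = y.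
Proof.
move=> TN [MN0 MNT] surj y; have [x xy] := surj (val y).
have [m Mm [n Nn mn]] : [set m + n | m in M & n in N] x by rewrite MNT.
have /mem_set Mm' := Mm.
exists (SubspaceType Mm'); apply: val_inj; rewrite /=.
pose p := T m - a *: m.
have shift (L : closedSubspace X) l : invariant_subspace T L ->
      subspace_set L l -> subspace_set L (T l - a *: l).
  move=> TL Ll; have [_ LP] := subspace_submod_closed L.
  rewrite addrC -scaleNr; apply/set_mem/LP; apply/mem_set => //.
  by apply: TL; exists l.
have Mp : subspace_set M (val y - p).
  have [_ MP] := subspace_submod_closed M.
  rewrite addrC -scaleN1r; apply/set_mem/MP; apply/mem_set; first exact: shift.
  exact/set_mem/(valP y).
have pE : val y - p = T n - a *: n.
  by rewrite -xy -mn linearD scalerDr opprD addrACA -/p addrAC subrr add0r.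
have : [set 0 : X] (val y - p).
  by rewrite -MN0; split => //; rewrite pE; exact: shift.
by move=> /= /eqP; rewrite subr_eq0 => /eqP ->.
Qed.

Theorem theorem2p6 (R : realType) (X Y : completeNormedModType R[i])
    (A : 'L(X)) (B : 'L(Y))
    (kato_A : generalized_Kato_decomposable A)
    (kato_B : generalized_Kato_decomposable B)
    (drazin_M : exists C : 'L(Y, X),
        generalized_Drazin_invertible (upper_triangular A B C)) :
  (exists (X1 X2 : closedSubspace X) (A1 : invariant_subspace A X1)
      (A2 : invariant_subspace A X2),
      [/\ is_direct_sum X1 X2, bounded_below (restriction A1)
        & quasinilpotent (restriction A2)]) /\
  (exists (Y1 Y2 : closedSubspace Y) (B1 : invariant_subspace B Y1)
      (B2 : invariant_subspace B Y2),
      [/\ is_direct_sum Y1 Y2, surjective (restriction B1)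
        & quasinilpotent (restriction B2)]) /\
  (exists2 delta : R, 0 < delta &
      forall lambda : R[i], 0 < `|lambda| < delta%:C ->
        beta (sub_scalar A lambda) = alpha (sub_scalar B lambda)).
Proof.
have [M1 [N1 [AM [AN [MN1 Asr Aqn]]]]] := kato_A.
have [M2 [N2 [BM [BN [MN2 Bsr Bqn]]]]] := kato_B.
have [C /Drazin_punctured_neighborhood[d d0 bij]] := drazin_M.
split; [|split].
- exists M1, N1, AM, AN; split => //.
  apply: (semi_regular_bounded_below Asr d0) => a /bij[inj _] x Ax.
  apply: val_inj => /=; apply: (upper_triangular_inj inj).
  by have := congr1 val Ax.
- exists M2, N2, BM, BN; split => //.
  apply: (semi_regular_surjective Bsr d0) => a /bij[_ surj].
  exact: (restriction_shift_surjective BM BN MN2 (upper_triangular_surj surj)).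
- exists d => // a; rewrite nrmE (ltcR 0) ltcR => /bij[inj surj].
  exact: beta_alpha_shift inj surj.
Qed.
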